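(* Let $(x_1,y_1),(x_2,y_2)\in\mathbb{Z}_{\ge 0}^2$ be such that $x_1-y_1$ and $x_2-y_2$ are not both $0$, and suppose $(x_1-y_1)(x_2-y_2)\le 0$. Let $n\in\mathbb{Z}_{\ge 1}$, let $a_1,a_2,d_1,d_2,p$, the semigroups $M_n$, $M_{n+p}$ and the homomorphisms $\pi_n$, $\pi_{n+p}$ be as defined in the context, and let $\Psi_n:\ker\pi_n\to\ker\pi_{n+p}$ be the map given by $$\Psi_n(z,z')=\begin{cases}\big(z+\ell(d_2e_1+d_1e_2),\; z'+\ell(d_1+d_2)e_0\big) & \text{if } |z|<|z'|,\\ \big(z+\ell(d_1+d_2)e_0,\; z'+\ell(d_2e_1+d_1e_2)\big) & \text{if } |z|>|z'|,\\ (z,z') & \text{if } |z|=|z'|,\end{cases}$$ where $\ell=\big||z|-|z'|\big|$. If $\{(z,z')\}$ is the minimal presentation of $M_n$, then $\{\Psi_n(z,z')\}$ is the minimal presentation of $M_{n+p}$.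
   Context: Setting: for fixed $r_1=(x_1,y_1)$, $r_2=(x_2,y_2)\in\mathbb{Z}_{\ge 0}^2$ and each $n\in\mathbb{Z}_{\ge 1}$, put $N=(n,n)$ and let $M_n=\langle N,\,N+r_1,\,N+r_2\rangle\subset\mathbb{Z}_{\ge 0}^2$ be the affine semigroup (additive submonoid, consisting of all $\mathbb{Z}_{\ge0}$-linear combinations) with these three generators. The factorization homomorphism $\pi_n:\mathbb{Z}_{\ge 0}^3\to\mathbb{Z}_{\ge 0}^2$ is $\pi_n(z_0,z_1,z_2)=z_0N+z_1(N+r_1)+z_2(N+r_2)$. Write $|z|=z_0+z_1+z_2$ and let $e_0,e_1,e_2$ be the standard basis vectors of $\mathbb{Z}^3$ (coordinates indexed $0,1,2$). Define $a_1=|x_1-y_1|$, $a_2=|x_2-y_2|$, $d_1=a_1/\gcd(a_1,a_2)$, $d_2=a_2/\gcd(a_1,a_2)$, and $p=|x_1y_2-y_1x_2|/\gcd(a_1,a_2)$. The kernel congruence is $\ker\pi_n=\{(z,z')\in\mathbb{Z}_{\ge0}^3\times\mathbb{Z}_{\ge0}^3:\pi_n(z)=\pi_n(z')\}$. A congruence on $\mathbb{Z}_{\ge0}^3$ is an equivalence relation closed under translation (if $(z,z')$ is in it, so is $(z+u,z'+u)$ for all $u\in\mathbb{Z}_{\ge0}^3$). A presentation of $M_n$ is a subset $\rho\subset\ker\pi_n$ such that $\ker\pi_n$ is the smallest congruence on $\mathbb{Z}_{\ge 0}^3$ containing $\rho$; it is minimal if no proper subset of $\rho$ is a presentation of $M_n$.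 In this setting a minimal presentation consists of a single pair $(z,z')$, unique up to interchanging $z$ and $z'$; this is what ''the minimal presentation'' refers to. *)

(* Defs.v *)
From mathcomp Require Import all_boot all_order all_algebra.
From mathcomp Require Import classical_sets.

Set Implicit Arguments.
Unset Strict Implicit.
Unset Printing Implicit Defensive.

Import GRing.Theory.
Local Open Scope ring_scope.
Local Open Scope classical_set_scope.

Definition congruence (V : nmodType) (R : set (V * V)) : Prop :=
  [/\ forall z, R (z, z),
      forall z z', R (z, z') -> R (z', z),
      forall z z' z'', R (z, z') -> R (z', z'') -> R (z, z'')
    & forall z z' u, R (z, z') -> R (z + u, z' + u)].

Definition ker_cong (V W : nmodType) (f : V -> W) : set (V * V) :=
  [set w | f w.1 = f w.2].

(* A presentation of the monoid [range f], with respect to the generators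
   enumerated by the factorization homomorphism [f]. *)
Definition presentation (V W : nmodType) (f : V -> W) (rho : set (V * V)) :
    Prop :=
  rho `<=` ker_cong f /\ smallest (@congruence V) rho = ker_cong f.

Definition minimal_presentation (V W : nmodType) (f : V -> W)
    (rho : set (V * V)) : Prop :=
  presentation f rho /\ forall rho', rho' `<` rho -> ~ presentation f rho'.

(* The affine semigroup <N, N + r1, N + r2>, N = (n, n), is the range of
   [fact_hom r1 r2 n]; [nat * nat] carries the componentwise addition. *)
Definition fact_hom (r1 r2 : nat * nat) (n : nat) (z : 'rV[nat]_3) :
    nat * nat :=
  let N : nat * nat := (n, n) in
  N *+ z 0 0 + (N + r1) *+ z 0 1 + (N + r2) *+ z 0 2%:R.

Definition len (z : 'rV[nat]_3) : nat := (\sum_(i < 3) z 0 i)%R.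

Definition e_ (i : 'I_3) : 'rV[nat]_3 := delta_mx 0 i.

(* [`|m - n|%N] is the absolute value of the integer difference, not of the
   truncated one. *)
Definition a_ (r : nat * nat) : nat := `|r.1 - r.2|%N.

Definition d1 (r1 r2 : nat * nat) : nat :=
  (a_ r1 %/ gcdn (a_ r1) (a_ r2))%N.

Definition d2 (r1 r2 : nat * nat) : nat :=
  (a_ r2 %/ gcdn (a_ r1) (a_ r2))%N.

Definition p_ (r1 r2 : nat * nat) : nat :=
  (`|(r1.1 * r2.2)%N - (r1.2 * r2.1)%N| %/ gcdn (a_ r1) (a_ r2))%N.

(* The formula does not involve n; it is meant on [ker_cong (fact_hom r1 r2 n)]
   for any n. *)
Definition Psi (r1 r2 : nat * nat) (w : 'rV[nat]_3 * 'rV[nat]_3) :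
    'rV[nat]_3 * 'rV[nat]_3 :=
  let: (z, z') := w in
  let l := `|len z - len z'|%N in
  let u := (e_ 1 *+ d2 r1 r2 + e_ 2%:R *+ d1 r1 r2) *+ l in
  let v := e_ 0 *+ (l * (d1 r1 r2 + d2 r1 r2))%N in
  if (len z < len z')%N then (z + u, z' + v)
  else if (len z' < len z)%N then (z + v, z' + u)
  else (z, z').

(* Main.v *)
Require Import Defs.
From mathcomp Require Import all_boot all_order all_algebra.
From mathcomp Require Import classical_sets.
From mathcomp Require Import zify ring.

(** The vector [d2 r1 + d1 r2] is [(p, p)]: as [x1 - y1] and [x2 - y2] are not of
    the same sign, the deviations of [r1] and [r2] from the diagonal cancel with
    these weights. Since [d1] and [d2] are coprime, a kernel pair [(a, b)] of
    [fact_hom] at parameter [m] satisfies [a - b = (w0, t d2, t d1)] for some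
    integer [t], and the diagonal part then gives
    [m w0 = - t (p + m (d1 + d2))]. The kernel lattice therefore has rank one.
    With [g = gcdn m p], [t] ranges over the multiples of [m / g], and the
    positive and negative parts of a generator are

      [(m / g) (d2 e1 + d1 e2)]  and  [((m / g) (d1 + d2) + p / g) e0].

    A kernel pair is a translate of a multiple of this pair, so the pair
    presents the monoid ([presentation_sides]). Its two entries are incomparable
    for the componentwise order, which makes it the only minimal presentation
    with one element, up to exchanging the entries ([presentation_unique],
    [minimal_presentation_sides]).

    Replacing [m] by [m + p] keeps [g], hence the length difference [p / g], and
    increases [m / g] by exactly [p / g]. This is what [Psi] does to the pair
    ([Psi_sides]). *)

Import GRing.Theory Num.Theory.

Local Open Scope ring_scope.
Local Open Scope classical_set_scope.

(** * Congruences generated by a single pair *)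

(** The divisibility preorder of a commutative monoid in additive notation; on
    [nat]-valued vectors it is the componentwise order. *)
Definition divides {V : nmodType} (z a : V) : Prop := exists u, a = z + u.

Lemma divides_add (V : nmodType) (z a u : V) :
  divides z a -> divides z (a + u).
Proof. by case=> v ->; exists (v + u); rewrite addrA. Qed.

Lemma congruence_smallest {V : nmodType} (rho : set (V * V)) :
  congruence (smallest (@congruence V) rho).
Proof.
split=> [z R [[r _ _ _] _]|z z' H R HR|z z' z'' H H' R HR|z z' u H R HR].
- exact: r.
- by case: (HR) => [[_ s _ _] _]; apply: s; exact: H.
- by case: (HR) => [[_ _ t _] _]; apply: t (H _ HR) (H' _ HR).
- by case: (HR) => [[_ _ _ c] _]; apply: c; exact: H.
Qed.

Lemma congruence_addr2 (V : nmodType) (R : set (V * V)) (a b c d : V) :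
  congruence R -> R (a, b) -> R (c, d) -> R (a + c, b + d).
Proof.
case=> _ _ t c0 Hab Hcd; apply: (t _ (b + c)); first exact: c0.
by rewrite ![b + _]addrC; exact: c0.
Qed.

Lemma congruence_mulrn {V : nmodType} {R : set (V * V)} {a b : V} (j : nat) :
  congruence R -> R (a, b) -> R (a *+ j, b *+ j).
Proof.
move=> HR Hab; elim: j => [|j IH]; first by rewrite !mulr0n; case: HR.
by rewrite !mulrS; exact: congruence_addr2.
Qed.

Lemma congruence_ker (V W : nmodType) (f : V -> W) :
  {morph f : x y / x + y} -> congruence (ker_cong f).
Proof.
move=> fD; split; rewrite /ker_cong /= => //.
  by move=> z z' z'' ->.
by move=> z z' u; rewrite !fD => ->.
Qed.

(** A rewriting step with the pair [(z, z')] only applies to elements that [z]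
    or [z'] divides. Formally, collapsing the ideal generated by [z] and [z'] to
    one class and leaving the rest discrete is a congruence containing the
    pair. *)
Lemma divides_of_smallest (V : nmodType) (z z' a b : V) :
  smallest (@congruence V) [set (z, z')] (a, b) -> a <> b ->
  divides z a \/ divides z' a.
Proof.
pose up a : Prop := divides z a \/ divides z' a.
have up_add c u : up c -> up (c + u).
  by case=> H; [left|right]; exact: divides_add.
pose R : set (V * V) := [set w | w.1 = w.2 \/ up w.1 /\ up w.2].
move=> /(_ R) H nab; case: H => [|//=|[]//]; split.
  split; rewrite /R /=.
  - by left.
  - by move=> c c' [->|[]]; [left|right].
  - move=> c c' c'' [->//|[uc uc']] [<-|[_ uc'']]; by right.
  - by move=> c c' u [->|[uc uc']]; [left|right; split; exact: up_add].
move=> _ -> /=; right; split.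
  by left; exists 0; rewrite addr0.
by right; exists 0; rewrite addr0.
Qed.

Lemma ker_divides {V W : nmodType} {f : V -> W} {z z' a b : V} :
  presentation f [set (z, z')] -> f a = f b -> a <> b ->
  divides z a \/ divides z' a.
Proof.
case=> _ E fab; apply: (@divides_of_smallest _ z z' a b).
by rewrite E.
Qed.

(** By [ker_divides], every entry of each of the two pairs is divisible by an
    entry of the other one. So an entry of [(z, z')] divides [a], and is itself
    divisible by [a] or by [b]; the latter would make [b] divide [a]. Hence this
    entry equals [a] by antisymmetry, and likewise for [b]. *)
Lemma presentation_unique {V W : nmodType} {f : V -> W} {a b z z' : V} :
  (forall c d : V, divides c d -> divides d c -> c = d) ->
  ~ divides a b -> ~ divides b a ->
  presentation f [set (a, b)] -> presentation f [set (z, z')] -> z <> z' ->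
  (z, z') = (a, b) \/ (z, z') = (b, a).
Proof.
move=> anti nab nba Pab Pz nzz'.
have tr (c d e : V) : divides c d -> divides d e -> divides c e.
  by move=> dcd [u ->]; exact: divides_add.
have neq : a <> b by move=> E; apply: nab; rewrite E; exists 0; rewrite addr0.
have fab : f a = f b by case: Pab => /(_ (a, b) erefl).
have fz : f z = f z' by case: Pz => /(_ (z, z') erefl).
have za := ker_divides Pz fab neq.
have zb := ker_divides Pz (esym fab) (nesym neq).
have az := ker_divides Pab fz nzz'.
have az' := ker_divides Pab (esym fz) (nesym nzz').
have only_a c : divides c a -> divides a c \/ divides b c -> c = a.
  by move=> ca [ac|bc]; [exact: anti|case: nba; exact: tr ca].
have only_b c : divides c b -> divides a c \/ divides b c -> c = b.
  by move=> cb [ac|bc]; [case: nab; exact: tr cb|exact: anti].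
case: za => Ha; case: zb => Hb.
- by case: nab; rewrite -(only_a _ Ha az).
- by left; rewrite (only_a _ Ha az) (only_b _ Hb az').
- by right; rewrite (only_a _ Ha az') (only_b _ Hb az).
- by case: nab; rewrite -(only_a _ Ha az').
Qed.

Lemma presentation_swap (V W : nmodType) (f : V -> W) (a b : V) :
  presentation f [set (a, b)] -> presentation f [set (b, a)].
Proof.
move=> [sub E]; split.
  by move=> _ -> /=; have := sub (a, b) erefl; rewrite /ker_cong /= => ->.
rewrite -E; apply/seteqP; split; apply: smallest_sub;
  try exact: congruence_smallest;
  move=> _ ->; case: (congruence_smallest [set (b, a)]) => _ s _ _;
  case: (congruence_smallest [set (a, b)]) => _ s' _ _;
  by [apply: s; apply: sub_gen_smallest | apply: s'; apply: sub_gen_smallest].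
Qed.

(** The only proper subset of a singleton is empty, and the empty relation
    generates equality, so minimality only says that the two entries differ. *)
Lemma minimal_presentation1 (V W : nmodType) (f : V -> W) (a b : V) :
  minimal_presentation f [set (a, b)] <->
  presentation f [set (a, b)] /\ a <> b.
Proof.
have cid : congruence [set w : V * V | w.1 = w.2].
  by split=> //= [c c' c'' -> | c c' u ->].
split=> [[P min]|[P nab]].
  split=> // E; apply: (min set0).
    by split=> // /(_ (a, b) erefl).
  split=> //; case: P => _ <-; apply/seteqP; split.
    by apply: smallest_sub => //; exact: congruence_smallest.
  apply: smallest_sub; first exact: congruence_smallest.
  by move=> _ ->; rewrite E; case: (@congruence_smallest V set0).
split=> // rho [sub nsub] [_ E].
have {}sub : rho `<=` [set w : V * V | w.1 = w.2].
  by move=> w rw; case: nsub => v ->; rewrite -(sub _ rw).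
have fab : smallest (@congruence V) rho (a, b).
  by rewrite E; case: P => /(_ (a, b) erefl).
exact: nab (smallest_sub cid sub fab).
Qed.

(** * The kernel of the factorization homomorphism *)

Lemma nat_mulrn (m k : nat) : m *+ k = (m * k)%N.
Proof. by rewrite -mulr_natr natn. Qed.

Lemma len_sum3 (z : 'rV[nat]_3) : len z = z 0 0 + z 0 1 + z 0 2%:R.
Proof.
rewrite /len !big_ord_recl big_ord0 /= addr0 addrA.
by congr (z 0 _ + z 0 _ + z 0 _); apply: val_inj.
Qed.

Lemma fact_homE (r1 r2 : nat * nat) (m : nat) (z : 'rV[nat]_3) :
  fact_hom r1 r2 m z =
  (m * len z + (r1.1 * z 0 1 + r2.1 * z 0 2%:R),
   m * len z + (r1.2 * z 0 1 + r2.2 * z 0 2%:R)).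
Proof.
rewrite len_sum3; apply: injective_projections; rewrite /fact_hom;
  rewrite !(raddfD, raddfMn) /= !nat_mulrn; lia.
Qed.

Lemma rV3_ext (a b : 'rV[nat]_3) :
  a 0 0 = b 0 0 -> a 0 1 = b 0 1 -> a 0 2%:R = b 0 2%:R -> a = b.
Proof.
move=> H0 H1 H2; apply/rowP => -[[|[|[|//]]] Hi].
- by rewrite (_ : Ordinal _ = 0) //; exact: val_inj.
- by rewrite (_ : Ordinal _ = 1) //; exact: val_inj.
- by rewrite (_ : Ordinal _ = 2%:R) //; exact: val_inj.
Qed.

Lemma divides_anti (a b : 'rV[nat]_3) : divides a b -> divides b a -> a = b.
Proof.
move=> [u ->] [v] /rowP H; apply/rowP => i; have := H i.
rewrite !mxE /GRing.add /=; lia.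
Qed.

(** The equality of the two coordinates of [c2 r1 + c1 r2] says that this
    vector lies on the diagonal, the line of [N]; coprimality then makes
    [(c2, c1)] a generator of all integer relations between [r1] and [r2] modulo
    this line, provided [r1] and [r2] are not both on it. *)
Definition balances (r1 r2 : nat * nat) (c1 c2 p : nat) : Prop :=
  [/\ coprime c1 c2,
      (c2 * r1.1 + c1 * r2.1 = p)%N, (c2 * r1.2 + c1 * r2.2 = p)%N
    & r1.1 <> r1.2 \/ r2.1 <> r2.2].

Lemma balances_len_gt0 {r1 r2 : nat * nat} {c1 c2 p : nat} :
  balances r1 r2 c1 c2 p -> (0 < c1 + c2)%N.
Proof. by case: c1 c2 => [[|c2]|c1 c2] // []. Qed.

Lemma coprime_proportional (c1 c2 : nat) (x y : int) :
  coprime c1 c2 -> c1%:Z * x = c2%:Z * y ->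
  exists t, x = c2%:Z * t /\ y = c1%:Z * t.
Proof.
move=> cop E; have /coprimezP[[u v] /= uv] : coprimez c1%:Z c2%:Z by [].
exists (u * y + v * x); split.
- by rewrite -[LHS]mul1r -uv mulrDl -mulrA E; ring.
- by rewrite -[LHS]mul1r -uv mulrDl -(mulrA v) -E; ring.
Qed.

Definition mixed (c1 c2 : nat) : 'rV[nat]_3 := e_ 1 *+ c2 + e_ 2%:R *+ c1.

Lemma mixedE (c1 c2 j : nat) :
  [/\ (mixed c1 c2 *+ j) 0 0 = 0, (mixed c1 c2 *+ j) 0 1 = (j * c2)%N
    & (mixed c1 c2 *+ j) 0 2%:R = (j * c1)%N].
Proof. by split; rewrite !(mulmxnE, mxE) /= !nat_mulrn; lia. Qed.

Lemma e0_mulrnE (j : nat) :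
  [/\ (e_ 0 *+ j) 0 0 = j, (e_ 0 *+ j) 0 1 = 0 & (e_ 0 *+ j) 0 2%:R = 0].
Proof. by split; rewrite !(mulmxnE, mxE) /= !nat_mulrn; lia. Qed.

Lemma len_mixed (c1 c2 j : nat) : len (mixed c1 c2 *+ j) = (j * (c1 + c2))%N.
Proof.
by have [H0 H1 H2] := mixedE c1 c2 j; rewrite len_sum3 H0 H1 H2; lia.
Qed.

Lemma len_e0 (j : nat) : len (e_ 0 *+ j) = j.
Proof. by have [H0 H1 H2] := e0_mulrnE j; rewrite len_sum3 H0 H1 H2; lia. Qed.

Lemma rV3_addE (a b : 'rV[nat]_3) i : (a + b) 0 i = a 0 i + b 0 i.
Proof. by rewrite mxE. Qed.

Lemma fact_homD (r1 r2 : nat * nat) (m : nat) :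
  {morph fact_hom r1 r2 m : x y / x + y}.
Proof.
move=> a b; rewrite !fact_homE !len_sum3 !rV3_addE.
by apply: injective_projections => /=; ring.
Qed.

(** * The generating pair of the kernel *)

(** When [balances] holds, [t] copies of [mixed c1 c2] factor [t (c1 + c2) N]
    plus the diagonal vector [t (p, p)]. This is a multiple of [N = (m, m)] when
    [m] divides [t p]; the least such positive [t] is [mult m p], and [t (p, p)]
    is then [excess m p] copies of [N]. *)
Definition mult (m p : nat) : nat := (m %/ gcdn m p)%N.
Definition excess (m p : nat) : nat := (p %/ gcdn m p)%N.

Definition mixed_side (c1 c2 p m : nat) : 'rV[nat]_3 :=
  mixed c1 c2 *+ mult m p.
Definition pure_side (c1 c2 p m : nat) : 'rV[nat]_3 :=
  e_ 0 *+ (mult m p * (c1 + c2) + excess m p).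

Lemma mult_excess {m : nat} (p : nat) : (0 < m)%N ->
  [/\ (mult m p * gcdn m p = m)%N, (excess m p * gcdn m p = p)%N,
      (0 < mult m p)%N, (0 < gcdn m p)%N & coprime (mult m p) (excess m p)].
Proof.
move=> m0; have g0 : (0 < gcdn m p)%N by rewrite gcdn_gt0 m0.
have E1 : (mult m p * gcdn m p = m)%N by rewrite divnK // dvdn_gcdl.
have E2 : (excess m p * gcdn m p = p)%N by rewrite divnK // dvdn_gcdr.
split=> //; first by rewrite lt0n; apply: contraTneq m0 => E; rewrite -E1 E.
rewrite /coprime -(eqn_pmul2r g0) mul1n muln_gcdl E1 E2 //.
Qed.

(** The kernel lattice is generated by [mixed_side - pure_side]. As the
    supports of the two sides are disjoint, subtracting the common part [c] of
    [a] and [b] leaves a multiple of each side. *)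
Lemma kernel_difference {r1 r2 : nat * nat} {c1 c2 p m : nat}
    {a b : 'rV[nat]_3} :
  balances r1 r2 c1 c2 p -> (0 < m)%N ->
  fact_hom r1 r2 m a = fact_hom r1 r2 m b -> (a 0%R 0%R <= b 0%R 0%R)%N ->
  exists c j, a = c + mixed_side c1 c2 p m *+ j
           /\ b = c + pure_side c1 c2 p m *+ j.
Proof.
move=> bal m0; have [cop Ex Ey ne] := bal.
rewrite !fact_homE !len_sum3 => -[Hx Hy] le0.
have [Em Ep t0 g0 cop'] := mult_excess p m0.
have [tau [T1 T2]] : exists t : int,
    (a 0 1)%:Z - (b 0 1)%:Z = c2%:Z * t /\
    (a 0 2%:R)%:Z - (b 0 2%:R)%:Z = c1%:Z * t.
  apply: coprime_proportional => //.
  (* Subtracting the second coordinate from the first one kills diagonal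
     vectors. So [(c2, c1)] and the difference of [a] and [b] are both
     orthogonal to the nonzero vector of deviations of [r1] and [r2] from the
     diagonal, which makes them proportional. *)
  have E : c2%:Z * (r1.1%:Z - r1.2%:Z) = - (c1%:Z * (r2.1%:Z - r2.2%:Z)) by lia.
  have F : ((a 0 1)%:Z - (b 0 1)%:Z) * (r1.1%:Z - r1.2%:Z)
         = - (((a 0 2%:R)%:Z - (b 0 2%:R)%:Z) * (r2.1%:Z - r2.2%:Z)) by lia.
  move: E F; set u := _ - (b 0 1)%:Z; set v := _ - (b 0 2%:R)%:Z => E F.
  apply/eqP; rewrite -subr_eq0; case: ne => ne.
  - have : (r1.1%:Z - r1.2%:Z) * (c1%:Z * u - c2%:Z * v) = 0.
      transitivity (c1%:Z * (u * (r1.1%:Z - r1.2%:Z))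
                    - v * (c2%:Z * (r1.1%:Z - r1.2%:Z))); first by ring.
      by rewrite E F; ring.
    by move/eqP; rewrite mulf_eq0 => /orP[/eqP|//]; lia.
  - have : (r2.1%:Z - r2.2%:Z) * (c1%:Z * u - c2%:Z * v) = 0.
      transitivity (u * (c1%:Z * (r2.1%:Z - r2.2%:Z))
                    - c2%:Z * (v * (r2.1%:Z - r2.2%:Z))); first by ring.
      by rewrite -[c1%:Z * _]opprK -E -[v * _]opprK -F; ring.
    by move/eqP; rewrite mulf_eq0 => /orP[/eqP|//]; lia.
have D0 := balances_len_gt0 bal.
(* The first coordinate alone now carries all the remaining information. *)
have Etau : m%:Z * ((b 0 0)%:Z - (a 0 0)%:Z)
          = tau * (p%:Z + m%:Z * (c1 + c2)%:Z).
  transitivity (m%:Z * (((a 0 1)%:Z - (b 0 1)%:Z)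
                        + ((a 0 2%:R)%:Z - (b 0 2%:R)%:Z))
    + r1.1%:Z * ((a 0 1)%:Z - (b 0 1)%:Z)
    + r2.1%:Z * ((a 0 2%:R)%:Z - (b 0 2%:R)%:Z)); first by lia.
  by rewrite T1 T2 -Ex !PoszD !PoszM; ring.
have tau0 : 0 <= tau.
  have P0 : 0 < p%:Z + m%:Z * (c1 + c2)%:Z by nia.
  by rewrite -(pmulr_lge0 _ P0) -Etau; nia.
case: tau tau0 T1 T2 Etau => // k _ T1 T2 Etau.
(* The multiple [k] is an integer multiple of [mult m p] because [m] divides
   [k p]. *)
have [q Eq] : exists q, b 0 0 = a 0 0 + q.
  by exists (b 0%R 0%R - a 0%R 0%R)%N; rewrite /GRing.add /= subnKC.
have Eq' : (mult m p * q = k * excess m p + mult m p * (k * (c1 + c2)))%N.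
  apply/eqP; rewrite -(eqn_pmul2r g0); apply/eqP.
  move: Etau; rewrite Eq => Etau.
  have {}Etau : (m * q = k * (p + m * (c1 + c2)))%N by nia.
  transitivity (m * q)%N; first by rewrite -[in RHS]Em; lia.
  rewrite Etau -{1}Em -{1}Ep; lia.
have /dvdnP[j Ej] : (mult m p %| k)%N.
  rewrite -(Gauss_dvdl _ cop').
  rewrite -(dvdn_addl _ (dvdn_mulr (k * (c1 + c2)) (dvdnn _))).
  by rewrite -Eq' dvdn_mulr.
have {}Eq' : q = (j * (mult m p * (c1 + c2) + excess m p))%N.
  apply/eqP; rewrite -(eqn_pmul2l t0) Eq' Ej; apply/eqP; lia.
(* The common part is the componentwise minimum of [a] and [b]. *)
exists (\row_i if i == 0 then a 0 0 else b 0 i), j.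
have [L0 L1 L2] := mixedE c1 c2 (mult m p * j).
have [R0 R1 R2] := e0_mulrnE ((mult m p * (c1 + c2) + excess m p) * j).
move: T1 T2 Eq; rewrite Ej Eq' => T1 T2 Eq.
split; rewrite /mixed_side /pure_side -mulrnA; apply: rV3_ext;
  rewrite rV3_addE ?(L0,L1,L2,R0,R1,R2) !mxE /=; lia.
Qed.

Lemma mixed_side_neq0 {r1 r2 : nat * nat} {c1 c2 p m : nat} :
  balances r1 r2 c1 c2 p -> (0 < m)%N ->
  (0 < mixed_side c1 c2 p m 0%R 1%R + mixed_side c1 c2 p m 0%R 2%:R)%N.
Proof.
move=> /balances_len_gt0 D0 /(mult_excess p) [_ _ t0 _ _].
by rewrite /mixed_side; have [_ -> ->] := mixedE c1 c2 (mult m p); nia.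
Qed.

Lemma presentation_sides {r1 r2 : nat * nat} {c1 c2 p m : nat} :
  balances r1 r2 c1 c2 p -> (0 < m)%N ->
  presentation (fact_hom r1 r2 m)
    [set (mixed_side c1 c2 p m, pure_side c1 c2 p m)].
Proof.
move=> bal m0; have kerG : fact_hom r1 r2 m (mixed_side c1 c2 p m)
                         = fact_hom r1 r2 m (pure_side c1 c2 p m).
  have [Em Ep _ _ _] := mult_excess p m0.
  have [_ Ex Ey _] := bal.
  rewrite !fact_homE len_mixed len_e0 /mixed_side /pure_side.
  have [_ -> ->] := mixedE c1 c2 (mult m p).
  have [_ -> ->] := e0_mulrnE (mult m p * (c1 + c2) + excess m p).
  have Es : (m * excess m p = mult m p * p)%N.
    by rewrite -[X in (X * _)%N = _]Em -[X in _ = (_ * X)%N]Ep mulnAC mulnA.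
  apply: injective_projections => /=.
    by move: Es; rewrite -[X in _ = (_ * X)%N]Ex; lia.
  by move: Es; rewrite -[X in _ = (_ * X)%N]Ey; lia.
split; first by move=> _ ->.
apply/seteqP; split.
  apply: smallest_sub; first exact/congruence_ker/fact_homD.
  by move=> _ ->.
have cong :=
  congruence_smallest [set (mixed_side c1 c2 p m, pure_side c1 c2 p m)].
have [refl sym _ trl] := cong.
have half a b : fact_hom r1 r2 m a = fact_hom r1 r2 m b ->
    (a 0%R 0%R <= b 0%R 0%R)%N ->
    smallest (@congruence _)
      [set (mixed_side c1 c2 p m, pure_side c1 c2 p m)] (a, b).
  move=> fab le0.
  have [c [j [-> ->]]] := kernel_difference bal m0 fab le0.
  rewrite ![c + _]addrC; apply: trl; apply: (congruence_mulrn _ cong).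
  exact: sub_gen_smallest.
move=> [a b] fab; case: (leqP (a 0 0) (b 0 0)) => [le0|/ltnW le0].
  exact: half.
by apply: sym; apply: half => //; rewrite fab.
Qed.

(** The supports of the two sides are disjoint and not empty, so the sides are
    incomparable and [presentation_unique] applies. *)
Lemma minimal_presentation_sides {r1 r2 : nat * nat} {c1 c2 p m : nat}
    (z z' : 'rV[nat]_3) :
  balances r1 r2 c1 c2 p -> (0 < m)%N ->
  minimal_presentation (fact_hom r1 r2 m) [set (z, z')] <->
  (z, z') = (mixed_side c1 c2 p m, pure_side c1 c2 p m) \/
  (z, z') = (pure_side c1 c2 p m, mixed_side c1 c2 p m).
Proof.
move=> bal m0; have P := presentation_sides bal m0.
have mixed0 := mixed_side_neq0 bal m0.
have [L0 _ _] := mixedE c1 c2 (mult m p).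
have [R0 R1 R2] := e0_mulrnE (mult m p * (c1 + c2) + excess m p).
have pure0 : (0 < pure_side c1 c2 p m 0%R 0%R)%N.
  have := balances_len_gt0 bal; have [_ _ t0 _ _] := mult_excess p m0.
  by rewrite /pure_side R0; nia.
have nmp : ~ divides (mixed_side c1 c2 p m) (pure_side c1 c2 p m).
  move=> [u E]; move: R1 R2; rewrite -/(pure_side c1 c2 p m) E !rV3_addE.
  by move: mixed0; rewrite /GRing.add /=; lia.
have npm : ~ divides (pure_side c1 c2 p m) (mixed_side c1 c2 p m).
  move=> [u E]; move: L0; rewrite -/(mixed_side c1 c2 p m) E !rV3_addE.
  by move: pure0; rewrite /GRing.add /=; lia.
have neq : mixed_side c1 c2 p m <> pure_side c1 c2 p m.
  by move=> E; apply: nmp; rewrite E; exists 0; rewrite addr0.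
split=> [/minimal_presentation1 [Pz nz]|].
  exact: presentation_unique divides_anti nmp npm P Pz nz.
case=> -[-> ->]; apply/minimal_presentation1; split=> //.
  exact: presentation_swap.
exact: nesym.
Qed.

(** * The shift map *)

Lemma Psi_swap (r1 r2 : nat * nat) (a b : 'rV[nat]_3) :
  Psi r1 r2 (b, a) = ((Psi r1 r2 (a, b)).2, (Psi r1 r2 (a, b)).1).
Proof. by rewrite /Psi distnC; case: ltngtP. Qed.

(** The case [len z = len z'] of [Psi] is covered too, since both increments are
    then multiples by zero. *)
Lemma Psi_le {r1 r2 : nat * nat} {z z' : 'rV[nat]_3} :
  (len z <= len z')%N ->
  Psi r1 r2 (z, z') =
  (z + mixed (d1 r1 r2) (d2 r1 r2) *+ (len z' - len z)%N,
   z' + e_ 0 *+ ((len z' - len z) * (d1 r1 r2 + d2 r1 r2))%N).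
Proof.
move=> le; rewrite /Psi distnEr // /mixed; case: ltngtP le => // -> _.
by rewrite subnn mul0n !mulr0n !addr0.
Qed.

Lemma lenD (a b : 'rV[nat]_3) : len (a + b) = len a + len b.
Proof. by rewrite !len_sum3 !rV3_addE; ring. Qed.

(** With [l] the length difference, the parameter shift from [m] to [m + p]
    makes the longer entry heavier by [l (p, p)] than the shorter one. Adding
    [l] mixed vectors to the shorter entry and [l (d1 + d2)] copies of [e_ 0] to
    the longer one restores equality, since the mixed vector factors
    [(d1 + d2) N + (p, p)]. *)
Lemma Psi_ker (r1 r2 : nat * nat) (p m : nat) w :
  balances r1 r2 (d1 r1 r2) (d2 r1 r2) p ->
  ker_cong (fact_hom r1 r2 m) w ->
  ker_cong (fact_hom r1 r2 (m + p)%N) (Psi r1 r2 w).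
Proof.
case: w => z z' [_ Ex Ey _].
have half a b : fact_hom r1 r2 m a = fact_hom r1 r2 m b -> (len a <= len b)%N ->
    ker_cong (fact_hom r1 r2 (m + p)%N) (Psi r1 r2 (a, b)).
  move=> fab le; rewrite (Psi_le le) /ker_cong /=.
  set l := (len b - len a)%N.
  have El : len b = (len a + l)%N by rewrite subnKC.
  move: fab; rewrite !fact_homE !lenD len_mixed len_e0 !rV3_addE.
  have [_ -> ->] := mixedE (d1 r1 r2) (d2 r1 r2) l.
  have [_ -> ->] := e0_mulrnE (l * (d1 r1 r2 + d2 r1 r2)).
  rewrite El => -[Hx Hy]; apply: injective_projections => /=.
    have : (l * (d2 r1 r2 * r1.1 + d1 r1 r2 * r2.1) = l * p)%N by rewrite Ex.
    by move: Hx; lia.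
  have : (l * (d2 r1 r2 * r1.2 + d1 r1 r2 * r2.2) = l * p)%N by rewrite Ey.
  by move: Hy; lia.
case: (leqP (len z) (len z')) => [le|/ltnW le] E; first exact: half.
by rewrite Psi_swap; symmetry; exact: half.
Qed.

(** The length difference of the two sides is [excess m p], which depends on [m]
    only through [gcdn m p = gcdn (m + p) p]; and [mult (m + p) p] is
    [mult m p + excess m p]. *)
Lemma Psi_sides (r1 r2 : nat * nat) (p m : nat) : (0 < m)%N ->
  let c1 := d1 r1 r2 in let c2 := d2 r1 r2 in
  Psi r1 r2 (mixed_side c1 c2 p m, pure_side c1 c2 p m)
  = (mixed_side c1 c2 p (m + p), pure_side c1 c2 p (m + p)).
Proof.
move=> m0 c1 c2.
have g0 : (0 < gcdn m p)%N by rewrite gcdn_gt0 m0.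
have Eg : gcdn (m + p) p = gcdn m p by rewrite gcdnC gcdnDr gcdnC.
have Es : excess (m + p) p = excess m p by rewrite /excess Eg.
have Et : mult (m + p) p = (mult m p + excess m p)%N.
  by rewrite /mult Eg divnDl // dvdn_gcdl.
have El :
  (len (pure_side c1 c2 p m) - len (mixed_side c1 c2 p m) = excess m p)%N.
  by rewrite len_mixed len_e0 addKn.
rewrite Psi_le; last by rewrite len_mixed len_e0 leq_addr.
by rewrite El /mixed_side /pure_side -!mulrnDr Es Et; congr (_, _ *+ _); lia.
Qed.

(** As the deviations from the diagonal are not of the same sign, [a_ r2] copies
    of [r1] and [a_ r1] copies of [r2] sum to a diagonal vector, whose
    coordinates are the absolute value of the determinant of [r1] and [r2].
    Dividing by the gcd gives [p_ r1 r2]. *)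
Lemma balances_d {x1 y1 x2 y2 : nat} :
  ~ (x1%:Z - y1%:Z = 0 /\ x2%:Z - y2%:Z = 0) ->
  (x1%:Z - y1%:Z) * (x2%:Z - y2%:Z) <= 0 ->
  let r1 := (x1, y1) in let r2 := (x2, y2) in
  balances r1 r2 (d1 r1 r2) (d2 r1 r2) (p_ r1 r2).
Proof.
move=> hr hsign r1 r2.
have g0 : (0 < gcdn (a_ r1) (a_ r2))%N.
  by rewrite gcdn_gt0 /a_ /=; apply/orP; lia.
have E1 : (d1 r1 r2 * gcdn (a_ r1) (a_ r2) = a_ r1)%N.
  by rewrite divnK ?dvdn_gcdl.
have E2 : (d2 r1 r2 * gcdn (a_ r1) (a_ r2) = a_ r2)%N.
  by rewrite divnK ?dvdn_gcdr.
(* In either case all absolute values open up with a known sign. *)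
have sgn : (y1 <= x1 /\ x2 <= y2)%N \/ (x1 <= y1 /\ y2 <= x2)%N by nia.
have Ex : (a_ r2 * x1 + a_ r1 * x2)%N = `|x1 * y2 - y1 * x2|%N.
  by rewrite /a_ /=; nia.
have Ey : (a_ r2 * y1 + a_ r1 * y2)%N = `|x1 * y2 - y1 * x2|%N.
  by rewrite /a_ /=; nia.
split.
- by rewrite /coprime -(eqn_pmul2r g0) mul1n muln_gcdl E1 E2.
- rewrite /p_ /= -Ex -[LHS](mulnK _ g0) mulnDl.
  by rewrite ![(_ * _ * gcdn _ _)%N]mulnAC E1 E2.
- rewrite /p_ /= -Ey -[LHS](mulnK _ g0) mulnDl.
  by rewrite ![(_ * _ * gcdn _ _)%N]mulnAC E1 E2.
- by rewrite /=; lia.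
Qed.

Theorem theorem3p3 (x1 y1 x2 y2 n : nat)
  (hr : ~ (x1%:Z - y1%:Z = 0 /\ x2%:Z - y2%:Z = 0))
  (hsign : (x1%:Z - y1%:Z) * (x2%:Z - y2%:Z) <= 0)
  (hn : (1 <= n)%N) :
  let r1 := (x1, y1) in
  let r2 := (x2, y2) in
  let p := p_ r1 r2 in
  (forall w, ker_cong (fact_hom r1 r2 n) w ->
     ker_cong (fact_hom r1 r2 (n + p)%N) (Psi r1 r2 w)) /\
  (forall z z' : 'rV[nat]_3,
     minimal_presentation (fact_hom r1 r2 n) [set (z, z')] ->
     minimal_presentation (fact_hom r1 r2 (n + p)%N) [set Psi r1 r2 (z, z')]).
Proof.
move=> r1 r2 p; have bal := balances_d hr hsign.
split=> [w|z z']; first exact: Psi_ker.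
have np : (0 < n + p)%N by rewrite addn_gt0 hn.
move=> /(minimal_presentation_sides _ _ bal hn) E.
case: E => ->; rewrite ?[Psi _ _ (pure_side _ _ _ _, _)]Psi_swap Psi_sides //;
  apply/(minimal_presentation_sides _ _ bal np); by [left|right].
Qed.
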